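(* Let $n$ be a nonnegative integer. Then, as an identity between meromorphic functions of the complex variable $x$ (in particular, for every complex $x$ that is not a negative integer), $$\sum_{k=0}^n\binom{2k+x}{k}(H_{2k+x}-H_{k+x})\,C_{n-k} = \binom{2n+x+1}{n}(H_{2n+x}-H_{n+x})-\frac{n}{(n+x+1)^2}\binom{2n+x}{n}.$$
   Context: $C_n=\frac{1}{n+1}\binom{2n}{n}$, $n\ge 0$, are the Catalan numbers. For complex $y$ and nonnegative integer $k$, $\binom{y}{k}=\frac{y(y-1)\cdots(y-k+1)}{k!}$. For complex $z$ not a negative integer, $H_z=\psi(z+1)+\gamma$, where $\psi=\Gamma'/\Gamma$ is the digamma function and $\gamma$ is the Euler--Mascheroni constant; in particular $H_{2k+x}-H_{k+x}=\sum_{i=1}^{k}\frac{1}{k+x+i}$. *)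

(* Defs.v *)
From Stdlib Require Import Reals Factorial.
From Coquelicot Require Import Coquelicot.

Open Scope C_scope.

Definition catalan (n : nat) : R := (/ INR (n + 1) * Binomial.C (2 * n) n)%R.

Fixpoint Cprod (f : nat -> C) (n : nat) : C :=
  match n with
  | O => 1
  | S m => Cprod f m * f m
  end.

Definition Cbinom (y : C) (k : nat) : C :=
  Cprod (fun i => y - INR i) k / INR (fact k).

Definition Cexp (z : C) : C :=
  (exp (Re z) * cos (Im z), exp (Re z) * sin (Im z))%R.

Definition C_lim_seq (u : nat -> C) : C :=
  (real (Lim_seq (fun n => Re (u n))), real (Lim_seq (fun n => Im (u n)))).

(* Euler's limit: Gamma(z) = lim n! n^z / (z (z + 1) ... (z + n)), where
   n^z = exp (z ln n).  It converges at every z other than 0, -1, -2, ...,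
   the poles of Gamma, where the value below is irrelevant. *)
Definition Gamma (z : C) : C :=
  C_lim_seq (fun n => INR (fact n) * Cexp (z * ln (INR n))
                      / Cprod (fun j => z + INR j) (n + 1)).

Definition digamma (z : C) : C := C_derive Gamma z / Gamma z.

Definition euler_gamma : R :=
  real (Lim_seq (fun n => sum_n_m (fun i => / INR i) 1 n - ln (INR n))%R).

Definition Harm (z : C) : C := digamma (z + 1) + euler_gamma.

Definition is_neg_int (z : C) : Prop :=
  exists m : nat, z = - INR (m + 1).

Definition holomorphic_at (f : C -> C) (a : C) : Prop :=
  locally a (fun z => @ex_derive C_AbsRing C_NormedModule f z).

(* Meromorphic functions on the whole plane are represented by total functions
   [C -> C]; their values on a closed discrete set carry no information, so
   only punctured neighbourhoods ([locally']) are inspected. *)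
Definition meromorphic (f : C -> C) : Prop :=
  forall a : C, exists (m : nat) (g : C -> C),
    holomorphic_at g a /\ locally' a (fun z => (z - a) ^ m * f z = g z).

Definition mero_eq (f g : C -> C) : Prop :=
  meromorphic f /\ meromorphic g /\
  forall a : C, locally' a (fun z => f z = g z).

(* Main.v *)
(* Write A_k(x) for the x-derivative of binom(2k+x, k), a polynomial in x.  Off
   the negative integers the digamma recursion psi(z+1) = psi(z) + 1/z gives
   A_k(x) = binom(2k+x, k) (H_{2k+x} - H_{k+x}), so both sides of the identity
   agree there with polynomials.

   Both P_k(x) = binom(2k+x, k) and A_k satisfy the Pascal recursion
   A_{k+1}(x+1) = A_{k+1}(x) + A_k(x+2).  It makes the convolution
   F_n(x, y) = sum_k A_k(x) P_{n-k}(y) depend on x + y only.  Since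
   C_j = 2 P_j(0) - P_j(1) and [j = 0] = 2 P_j(-1) - P_j(0), shifting one unit
   from y to x yields sum_k A_k(x) C_{n-k} = A_n(x+1), which is the right-hand
   side.

   The digamma recursion holds because psi(z) is the limit of
   ln n - sum_{j <= n} 1/(z+j), the logarithmic derivative of the terms of
   Euler's limit: these terms and their derivatives have increments O(1/n^2),
   uniformly near z, and the terms stay bounded away from 0. *)

Require Import Defs.
From Stdlib Require Import Reals Factorial Lra Lia.
From Coquelicot Require Import Coquelicot.

Open Scope C_scope.

(** * Convolution of Pascal families with the Catalan numbers *)

Fixpoint Csum (f : nat -> C) (n : nat) : C :=
  match n with
  | O => 0
  | S m => Csum f m + f m
  end.

(* The derivative of [Cprod f n] when every factor has derivative 1. *)
Fixpoint dCprod (f : nat -> C) (n : nat) : C :=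
  match n with
  | O => 0
  | S m => dCprod f m * f m + Cprod f m
  end.

Lemma Csum_ext f g n : (forall i, (i < n)%nat -> f i = g i) -> Csum f n = Csum g n.
Proof.
  induction n as [|n IH]; intros H; simpl; auto.
  rewrite IH, (H n); auto.
Qed.

Lemma Csum_shift f n : Csum f (S n) = f 0%nat + Csum (fun i => f (S i)) n.
Proof.
  induction n as [|n IH]; [simpl; ring|].
  change (Csum f (S n) + f (S n) = f 0%nat + (Csum (fun i => f (S i)) n + f (S n))).
  rewrite IH; ring.
Qed.

Lemma Csum_plus f g n : Csum (fun i => f i + g i) n = Csum f n + Csum g n.
Proof. induction n as [|n IH]; simpl; [ring | rewrite IH; ring]. Qed.

Lemma Csum_scal c f n : Csum (fun i => c * f i) n = c * Csum f n.
Proof. induction n as [|n IH]; simpl; [ring | rewrite IH; ring]. Qed.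

Lemma sum_n_Csum (f : nat -> C) n : sum_n f n = Csum f (S n).
Proof.
  induction n as [|n IH].
  - rewrite sum_O; simpl; ring.
  - rewrite sum_Sn, IH; reflexivity.
Qed.

Lemma Cprod_ext f g n : (forall i, (i < n)%nat -> f i = g i) -> Cprod f n = Cprod g n.
Proof.
  induction n as [|n IH]; intros H; simpl; auto.
  rewrite IH, (H n); auto.
Qed.

Lemma dCprod_ext f g n : (forall i, (i < n)%nat -> f i = g i) -> dCprod f n = dCprod g n.
Proof.
  induction n as [|n IH]; intros H; simpl; auto.
  rewrite IH, (H n), (Cprod_ext f g); auto.
Qed.

Lemma Cprod_shift f n : Cprod f (S n) = f 0%nat * Cprod (fun i => f (S i)) n.
Proof.
  induction n as [|n IH]; [simpl; ring|].
  change (Cprod f (S n) * f (S n) = f 0%nat * (Cprod (fun i => f (S i)) n * f (S n))).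
  rewrite IH; ring.
Qed.

Lemma dCprod_shift f n :
  dCprod f (S n) = Cprod (fun i => f (S i)) n + f 0%nat * dCprod (fun i => f (S i)) n.
Proof.
  induction n as [|n IH]; [simpl; ring|].
  change (dCprod f (S n) * f (S n) + Cprod f (S n) =
    Cprod (fun i => f (S i)) n * f (S n)
    + f 0%nat * (dCprod (fun i => f (S i)) n * f (S n) + Cprod (fun i => f (S i)) n)).
  rewrite IH, Cprod_shift; ring.
Qed.

(** Logarithmic differentiation. The harmonic sums of the theorem enter through these
    reciprocals. *)
Lemma dCprod_log (f : nat -> C) n :
  (forall i, (i < n)%nat -> f i <> 0) ->
  dCprod f n = Cprod f n * Csum (fun i => / f i) n.
Proof.
  induction n as [|n IH]; intros H; simpl; [ring|].
  rewrite IH by auto. field. apply H; lia.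
Qed.

Lemma RtoC_S n : RtoC (INR (S n)) = INR n + 1.
Proof. now rewrite S_INR, RtoC_plus. Qed.

Lemma INR_double n : RtoC (INR (2 * n)) = 2 * INR n.
Proof. now rewrite mult_INR, RtoC_mult. Qed.

Lemma INR_double_S k : RtoC (INR (2 * S k)) = INR (2 * k) + 2.
Proof. rewrite !INR_double, RtoC_S. ring. Qed.

Lemma INR_C_neq_0 n : (0 < n)%nat -> RtoC (INR n) <> 0.
Proof. intros H E; apply RtoC_inj in E; revert E; apply not_0_INR; lia. Qed.

Lemma fact_C_neq_0 n : RtoC (INR (fact n)) <> 0.
Proof. apply INR_C_neq_0, lt_O_fact. Qed.

Lemma fact_C_S n : RtoC (INR (fact (S n))) = (INR n + 1) * INR (fact n).
Proof. change (fact (S n)) with (S n * fact n)%nat. now rewrite mult_INR, RtoC_mult, RtoC_S. Qed.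

Lemma S_C_neq_0 n : RtoC (INR n) + 1 <> 0.
Proof. rewrite <- RtoC_S; apply INR_C_neq_0; lia. Qed.

(** The derivative of [Cbinom y k] in [y], given algebraically by the product rule, so that it is a
    polynomial without exceptional points. *)
Definition dCbinom (y : C) (k : nat) : C :=
  dCprod (fun i => y - INR i) k / INR (fact k).

Lemma falling_shift y n :
  Cprod (fun i => y + 1 - INR i) (S n) = (y + 1) * Cprod (fun i => y - INR i) n.
Proof.
  rewrite Cprod_shift; change (INR 0) with 0%R. f_equal; [ring|].
  apply Cprod_ext; intros i _. rewrite RtoC_S; ring.
Qed.

Lemma dfalling_shift y n :
  dCprod (fun i => y + 1 - INR i) (S n) =
  Cprod (fun i => y - INR i) n + (y + 1) * dCprod (fun i => y - INR i) n.
Proof.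
  rewrite dCprod_shift; change (INR 0) with 0%R.
  rewrite (Cprod_ext _ (fun i => y - INR i)), (dCprod_ext _ (fun i => y - INR i));
    [ring | |]; intros i _; rewrite RtoC_S; ring.
Qed.

Lemma Cbinom_pascal y k : Cbinom (y + 1) (S k) = Cbinom y (S k) + Cbinom y k.
Proof.
  unfold Cbinom. rewrite falling_shift, fact_C_S; cbn [Cprod].
  pose proof (fact_C_neq_0 k); pose proof (S_C_neq_0 k). field; auto.
Qed.

Lemma dCbinom_pascal y k : dCbinom (y + 1) (S k) = dCbinom y (S k) + dCbinom y k.
Proof.
  unfold dCbinom. rewrite dfalling_shift, fact_C_S; cbn [dCprod].
  pose proof (fact_C_neq_0 k); pose proof (S_C_neq_0 k). field; auto.
Qed.

(** Pascal's rule for the upper index 2k + x: lowering k by one while keeping that index raises x by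
    2. *)
Definition pascal_family (A : nat -> C -> C) : Prop :=
  (forall x, A 0%nat (x + 1) = A 0%nat x) /\
  (forall k x, A (S k) (x + 1) = A (S k) x + A k (x + 2)).

Definition cbin (k : nat) (x : C) : C := Cbinom (INR (2 * k) + x) k.
Definition dcbin (k : nat) (x : C) : C := dCbinom (INR (2 * k) + x) k.

Lemma cbin_pascal : pascal_family cbin.
Proof.
  split; unfold cbin; [reflexivity|]. intros k x.
  rewrite Cplus_assoc, Cbinom_pascal, INR_double_S. do 2 f_equal; ring.
Qed.

Lemma dcbin_pascal : pascal_family dcbin.
Proof.
  split; unfold dcbin; [reflexivity|]. intros k x.
  rewrite Cplus_assoc, dCbinom_pascal, INR_double_S. do 2 f_equal; ring.
Qed.

Definition conv (A B : nat -> C -> C) (n : nat) (x y : C) : C :=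
  Csum (fun k => A k x * B (n - k)%nat y) (S n).

(** The term k = 0 is unchanged by periodicity of [A 0]; Pascal's rule splits every other term, and
    reindexing turns the new parts into a convolution of order n. *)
Lemma conv_left A B n x y : pascal_family A ->
  conv A B (S n) (x + 1) y = conv A B (S n) x y + conv A B n (x + 2) y.
Proof.
  intros [A0 AS]. unfold conv. rewrite !(Csum_shift _ (S n)), A0, <- Cplus_assoc, <- Csum_plus.
  f_equal. apply Csum_ext; intros k _. rewrite AS.
  change (S n - S k)%nat with (n - k)%nat. ring.
Qed.

Lemma conv_right A B n x y : pascal_family B ->
  conv A B (S n) x (y + 1) = conv A B (S n) x y + conv A B n x (y + 2).
Proof.
  intros [B0 BS]. unfold conv.
  set (f z := fun k => A k x * B (S n - k)%nat z).
  change (Csum (f (y + 1)) (S n) + f (y + 1) (S n) =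
          Csum (f y) (S n) + f y (S n) + Csum (fun k => A k x * B (n - k)%nat (y + 2)) (S n)).
  rewrite (Csum_ext (f (y + 1)) (fun k => f y k + A k x * B (n - k)%nat (y + 2))).
  - rewrite Csum_plus. unfold f. rewrite Nat.sub_diag, B0. ring.
  - intros k Hk. unfold f. replace (S n - k)%nat with (S (n - k)) by lia. rewrite BS; ring.
Qed.

(** Induction on n: the recursions on the two sides leave lower convolutions at (x + 2, y) and (x, y
    + 2), which the induction hypothesis identifies by moving one unit twice. *)
Lemma conv_transfer A B n x y : pascal_family A -> pascal_family B ->
  conv A B n (x + 1) y = conv A B n x (y + 1).
Proof.
  intros HA HB. revert x y. induction n as [|n IH]; intros x y.
  - destruct HA as [A0 _], HB as [B0 _]. unfold conv; simpl. now rewrite A0, B0.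
  - rewrite conv_left, conv_right by auto. f_equal.
    replace (x + 2) with (x + 1 + 1) by ring. replace (y + 2) with (y + 1 + 1) by ring.
    now rewrite !IH.
Qed.

(** Serves twice with [B := cbin]: at y = 0 the bracket is a Catalan number, at y = -1 it is a
    Kronecker delta. *)
Lemma conv_2_minus A B n x y :
  2 * conv A B n x y - conv A B n x (y + 1) =
  Csum (fun k => A k x * (2 * B (n - k)%nat y - B (n - k)%nat (y + 1))) (S n).
Proof.
  unfold conv.
  replace (2 * _ - _) with
    (2 * Csum (fun k => A k x * B (n - k)%nat y) (S n)
     + (- (1)) * Csum (fun k => A k x * B (n - k)%nat (y + 1)) (S n)) by ring.
  rewrite <- !Csum_scal, <- Csum_plus. apply Csum_ext; intros; ring.
Qed.

Lemma falling_fact k m : Cprod (fun i => INR (m + k) - INR i) k * INR (fact m) = INR (fact (m + k)).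
Proof.
  revert m; induction k as [|k IH]; intros m; cbn [Cprod].
  - rewrite Nat.add_0_r; ring.
  - rewrite <- plus_n_Sm. change (S (m + k)) with (S m + k)%nat.
    rewrite <- (IH (S m)), fact_C_S.
    replace (RtoC (INR (S m + k)) - INR k) with (INR m + 1)
      by (rewrite plus_INR, RtoC_plus, RtoC_S; ring).
    ring.
Qed.

Lemma cbin_0_C n : cbin n 0 = Binomial.C (2 * n) n.
Proof.
  unfold cbin, Cbinom, Binomial.C. replace (2 * n - n)%nat with n by lia.
  pose proof (falling_fact n n) as H. replace (n + n)%nat with (2 * n)%nat in H by lia.
  rewrite RtoC_div, RtoC_mult, <- H by (apply Rmult_integral_contrapositive_currified; apply INR_fact_neq_0).
  rewrite (Cprod_ext _ (fun i => INR (2 * n) - INR i)).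
  - field. apply fact_C_neq_0.
  - intros; ring.
Qed.

(** Since binom(2n+1, n) = (2n+1)/(n+1) binom(2n, n), the difference is binom(2n, n) times 2 -
    (2n+1)/(n+1) = 1/(n+1). *)
Lemma cbin_catalan n : 2 * cbin n 0 - cbin n (0 + 1) = catalan n.
Proof.
  unfold catalan. rewrite RtoC_mult, <- cbin_0_C, RtoC_inv, Nat.add_1_r, RtoC_S by (apply not_0_INR; lia).
  unfold cbin, Cbinom.
  assert (H := falling_shift (INR (2 * n) + 0) n). cbn [Cprod] in H.
  rewrite !(Cprod_ext (fun i => INR (2 * n) + (0 + 1) - INR i) (fun i => INR (2 * n) + 0 + 1 - INR i))
    by (intros; ring).
  set (p := Cprod (fun i => INR (2 * n) + 0 + 1 - INR i) n) in *.
  set (q := Cprod (fun i => INR (2 * n) + 0 - INR i) n) in *.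
  pose proof (fact_C_neq_0 n) as F; pose proof (S_C_neq_0 n) as S.
  assert (E : p = (INR (2 * n) + 0 + 1) * q / (INR n + 1)).
  { rewrite <- H, INR_double. field.
    replace (2 * INR n + 0 + 1 - INR n) with (INR n + 1) by ring. auto. }
  rewrite E, INR_double. field; auto.
Qed.

(** For n > 0 this is binom(2n, n) = 2 binom(2n-1, n); for n = 0 both binomials are 1. *)
Lemma cbin_delta n : 2 * cbin n (- (1)) - cbin n (- (1) + 1) = if Nat.eqb n 0 then 1 else 0.
Proof.
  destruct n as [|n]; unfold cbin, Cbinom; [simpl; field|].
  simpl Nat.eqb; cbv iota. rewrite (Cprod_ext (fun i => INR (2 * S n) + (- (1) + 1) - INR i)
     (fun i => INR (2 * S n) - 1 + 1 - INR i)) by (intros; ring).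
  rewrite falling_shift; cbn [Cprod].
  rewrite (Cprod_ext (fun i => INR (2 * S n) + - (1) - INR i)
     (fun i => INR (2 * S n) - 1 - INR i)) by (intros; ring).
  rewrite INR_double, RtoC_S.
  field. apply fact_C_neq_0.
Qed.

Lemma conv_catalan A n x : pascal_family A ->
  Csum (fun k => A k x * catalan (n - k)) (S n) = A n (x + 1).
Proof.
  intros HA.
  rewrite (Csum_ext _ (fun k => A k x * (2 * cbin (n - k) 0 - cbin (n - k) (0 + 1))))
    by (intros; now rewrite cbin_catalan).
  rewrite <- conv_2_minus.
  (* Two transfers bring both convolutions to the left argument x + 1, with right arguments -1 and
     0. The delta then keeps only the term k = n. *)
  rewrite <- (conv_transfer A cbin n x 0) by auto using cbin_pascal.
  replace (RtoC 0) with (- (1) + 1) by ring.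
  rewrite <- (conv_transfer A cbin n x (- (1))) by auto using cbin_pascal.
  rewrite conv_2_minus, (Csum_ext _ (fun k => A k (x + 1) * (if Nat.eqb (n - k) 0 then 1 else 0)))
    by (intros; now rewrite cbin_delta).
  simpl. rewrite Nat.sub_diag; simpl.
  rewrite (Csum_ext _ (fun k => 0 * 0)).
  - rewrite Csum_scal; ring.
  - intros k Hk. replace (n - k)%nat with (S (n - k - 1)) by lia. simpl; ring.
Qed.

(** With y = 2n + x, replacing y by y + 1 adds 1/(y+1) to the reciprocal sum and removes 1/(n+x+1).
    Multiplied by binom(y+1, n) = (y+1)/(n+x+1) binom(y, n), this change is the last term. The
    factor y + 1 may vanish, so [dfalling_shift] is used instead of dividing by it. *)
Lemma dcbin_succ n x :
  (forall i, (i < n)%nat -> INR (2 * n) + x - INR i <> 0) ->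
  dcbin n (x + 1) =
  Cbinom (INR (2 * n) + x + 1) n * Csum (fun i => / (INR (2 * n) + x - INR i)) n
  - INR n / (INR n + x + 1) ^ 2 * Cbinom (INR (2 * n) + x) n.
Proof.
  intros H. unfold dcbin, dCbinom, Cbinom. rewrite Cplus_assoc.
  destruct n as [|n].
  { simpl. unfold Cdiv. ring. }
  assert (Hn := H n ltac:(lia)).
  (* The denominator is the last factor of the falling product, hence nonzero by [H]. *)
  replace (INR (S n) + x + 1) with (INR (2 * S n) + x - INR n).
  2:{ rewrite INR_double, RtoC_S. ring. }
  set (y := INR (2 * S n) + x) in *.
  rewrite falling_shift, dfalling_shift, dCprod_log by auto.
  cbn [Cprod]. cbn [Csum]. rewrite fact_C_S, RtoC_S.
  pose proof (fact_C_neq_0 n); pose proof (S_C_neq_0 n). field; auto.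
Qed.

(** * Modulus inequalities and limits of complex sequences *)

Lemma Cmod_le_Re_Im z : (Cmod z <= Rabs (Re z) + Rabs (Im z))%R.
Proof.
  replace z with (RtoC (Re z) + Ci * RtoC (Im z)) at 1
    by (destruct z; unfold Ci, RtoC, Cplus, Cmult; simpl; f_equal; ring).
  eapply Rle_trans; [apply Cmod_triangle|].
  rewrite Cmod_mult, Cmod_Ci, !Cmod_R. lra.
Qed.

Lemma Im_le_Cmod z : (Rabs (Im z) <= Cmod z)%R.
Proof. eapply Rle_trans; [|apply Rmax_Cmod]. apply Rmax_r. Qed.

Lemma Cmod_minus_sym z w : Cmod (z - w) = Cmod (w - z).
Proof. rewrite <- Cmod_opp. f_equal; ring. Qed.

Lemma Cmod_minus_le z w : (Cmod z - Cmod w <= Cmod (z - w))%R.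
Proof. pose proof (Cmod_triangle (z - w) w) as H. replace (z - w + w) with z in H by ring. lra. Qed.

Lemma Cmod_pair_le_Re t s y : (Cmod ((t, y) - (s, y)) <= Rabs (t - s))%R.
Proof.
  eapply Rle_trans; [apply Cmod_le_Re_Im|]. simpl.
  replace (y + - y)%R with 0%R by ring. rewrite Rabs_R0. unfold Rminus; lra.
Qed.

(** Genuine convergence to a finite limit, whereas [C_lim_seq] is total and returns a value for
    divergent sequences too. *)
Definition is_limC (u : nat -> C) (l : C) : Prop :=
  is_lim_seq (fun n => Re (u n)) (Re l) /\ is_lim_seq (fun n => Im (u n)) (Im l).

Lemma is_limC_unique u l : is_limC u l -> C_lim_seq u = l.
Proof.
  intros [H1 H2]. unfold C_lim_seq.
  rewrite (is_lim_seq_unique _ _ H1), (is_lim_seq_unique _ _ H2). now destruct l.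
Qed.

Lemma is_limC_mult u v l m :
  is_limC u l -> is_limC v m -> is_limC (fun n => u n * v n) (l * m).
Proof.
  intros [H1 H2] [H3 H4]; split; simpl.
  - apply is_lim_seq_minus'; apply is_lim_seq_mult'; assumption.
  - apply is_lim_seq_plus'; apply is_lim_seq_mult'; assumption.
Qed.

Lemma is_limC_minus u v l m :
  is_limC u l -> is_limC v m -> is_limC (fun n => u n - v n) (l - m).
Proof.
  intros [H1 H2] [H3 H4]; split; simpl.
  - apply (is_lim_seq_minus' _ _ _ _ H1 H3).
  - apply (is_lim_seq_minus' _ _ _ _ H2 H4).
Qed.

Lemma is_limC_bound u l N b :
  (forall n, (N <= n)%nat -> (Cmod (u n - l) <= b / INR n)%R) -> is_limC u l.
Proof.
  intros H.
  assert (L0 : forall c : R, is_lim_seq (fun n => c + b / INR n)%R c).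
  { intros c. replace (Finite c) with (Finite (c + b * 0)) by (f_equal; ring).
    apply is_lim_seq_plus'; [apply is_lim_seq_const|].
    apply (is_lim_seq_scal_l _ b 0).
    replace (Finite 0) with (Rbar_inv p_infty) by reflexivity.
    apply is_lim_seq_inv; [apply is_lim_seq_INR | easy]. }
  assert (L1 : forall c : R, is_lim_seq (fun n => c - b / INR n)%R c).
  { intros c. replace (Finite c) with (Finite (c + (c - c)))%R by (f_equal; ring).
    apply (is_lim_seq_ext (fun n => c + (c - (c + b / INR n)))%R); [intros; ring|].
    apply is_lim_seq_plus'; [apply is_lim_seq_const|].
    apply is_lim_seq_minus'; [apply is_lim_seq_const | apply L0]. }
  split.
  - apply is_lim_seq_le_le_loc with (3 := L0 (Re l)) (2 := L1 (Re l)).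
    exists N; intros n Hn. specialize (H n Hn).
    pose proof (re_le_Cmod (u n - l)) as E; simpl in E.
    pose proof (Rle_trans _ _ _ E H) as E'. apply Rabs_le_between in E'. unfold Re; lra.
  - apply is_lim_seq_le_le_loc with (3 := L0 (Im l)) (2 := L1 (Im l)).
    exists N; intros n Hn. specialize (H n Hn).
    pose proof (Im_le_Cmod (u n - l)) as E; simpl in E.
    pose proof (Rle_trans _ _ _ E H) as E'. apply Rabs_le_between in E'. unfold Im; lra.
Qed.

Lemma is_limC_neq_0 u l N c :
  (0 < c)%R -> (forall n, (N <= n)%nat -> (c <= Cmod (u n))%R) -> is_limC u l -> l <> 0.
Proof.
  intros Hc H [H1 H2] ->.
  apply is_lim_seq_abs in H1. apply is_lim_seq_abs in H2. simpl in H1, H2.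
  pose proof (is_lim_seq_plus' _ _ _ _ H1 H2) as H3.
  assert (L : Rbar_le c (Finite (Rabs 0 + Rabs 0))).
  { apply is_lim_seq_le_loc with (2 := is_lim_seq_const c) (3 := H3).
    exists N; intros n Hn. eapply Rle_trans; [apply H, Hn | apply Cmod_le_Re_Im]. }
  simpl in L. rewrite Rabs_R0 in L. lra.
Qed.

(** * Derivatives in the real direction *)

(* [C_derive] only inspects difference quotients with real increments. *)
Definition is_hderive (f : C -> C) (z l : C) : Prop :=
  is_derive (fun t => Re (f (t, Im z))) (Re z) (Re l) /\
  is_derive (fun t => Im (f (t, Im z))) (Re z) (Im l).

Lemma is_hderive_mult f g z lf lg : is_hderive f z lf -> is_hderive g z lg ->
  is_hderive (fun w => f w * g w) z (lf * g z + f z * lg).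
Proof.
  destruct z as [t y]. intros [F1 F2] [G1 G2]. simpl in *. split; simpl.
  - evar_last.
    + apply @is_derive_minus; apply (is_derive_mult (K := R_AbsRing)); eauto; intros; apply Rmult_comm.
    + unfold minus, plus, opp, mult; simpl. unfold Re, Im; ring.
  - evar_last.
    + apply @is_derive_plus; apply (is_derive_mult (K := R_AbsRing)); eauto; intros; apply Rmult_comm.
    + unfold minus, plus, opp, mult; simpl. unfold Re, Im; ring.
Qed.

Lemma is_hderive_plus f g z lf lg : is_hderive f z lf -> is_hderive g z lg ->
  is_hderive (fun w => f w + g w) z (lf + lg).
Proof.
  intros [F1 F2] [G1 G2]; split; simpl.
  - apply (is_derive_plus _ _ _ _ _ F1 G1).
  - apply (is_derive_plus _ _ _ _ _ F2 G2).
Qed.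

Lemma is_hderive_const c z : is_hderive (fun _ => c) z 0.
Proof. split; apply @is_derive_const. Qed.

Lemma is_hderive_inv z c : z + c <> 0 ->
  is_hderive (fun w => / (w + c)) z (- / ((z + c) * (z + c))).
Proof.
  destruct z as [t y], c as [a b]. intros H.
  assert (N : ((t + a) ^ 2 + (y + b) ^ 2 <> 0)%R).
  { intros E. apply H. rewrite <- !Rsqr_pow2 in E. apply Rplus_sqr_eq_0 in E as [E1 E2].
    unfold Cplus, RtoC; simpl. now rewrite E1, E2. }
  assert (N2 : (((t + a) ^ 2 + (y + b) ^ 2) ^ 2 <> 0)%R) by now apply pow_nonzero.
  split; simpl; (auto_derive; [intros E; apply N; rewrite <- E; ring |
    field; split; intros E; [apply N2 | apply N]; rewrite <- E; ring]).
Qed.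

Lemma is_hderive_Cexp L z :
  is_hderive (fun w => Cexp (w * RtoC L)) z (RtoC L * Cexp (z * RtoC L)).
Proof.
  destruct z as [t y]; split; simpl;
    (auto_derive; [easy | unfold RtoC, Cexp, Cmult; simpl; unfold Re, Im, Rminus; simpl; ring]).
Qed.

Lemma C_derive_hderive f z l : is_hderive f z l -> C_derive f z = l.
Proof.
  intros [H1 H2].
  (* For a real increment, each component [h] of the complex difference quotient is the real
     difference quotient of that component. Agreement is asked only off [t], as [Lim] ignores the
     value there. *)
  assert (Q : forall (g : R -> R) (t l : R), is_derive g t l ->
             forall h : R -> R, (forall x, x <> t -> h x = (g x - g t) / (x - t))%R -> Lim h t = l).
  { intros g t m Hg h Hh. apply is_lim_unique, is_lim_spec. intros eps.
    apply is_derive_Reals in Hg. destruct (Hg eps (cond_pos eps)) as [d Hd].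
    exists d. intros x Hx Hne. rewrite Hh by auto.
    specialize (Hd (x - t)%R ltac:(lra) Hx).
    replace (t + (x - t))%R with (x : R) in Hd by (simpl; lra). exact Hd. }
  unfold C_derive, C_lim. destruct z as [t y]; simpl in *.
  rewrite (Q _ _ _ H1), (Q _ _ _ H2); [now destruct l | |];
    intros x Hx; simpl; unfold Re, Im; simpl;
    replace (y + - y)%R with 0%R by ring; field; lra.
Qed.

(** * Estimates for Euler's product *)

(** Half-angle formula together with |sin t| <= |t|, the latter by sign of t and by |sin t| <= 1
    when |t| > 1. *)
Lemma cos_bound b : (0 <= 1 - cos b <= b ^ 2 / 2)%R.
Proof.
  assert (H : (1 - cos b = 2 * (sin (b / 2)) ^ 2)%R).
  { replace b with (2 * (b / 2))%R at 1 by field. rewrite cos_2a_sin. ring. }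
  assert (S : (Rabs (sin (b / 2)) <= Rabs (b / 2))%R).
  { destruct (Rle_lt_dec 0 (b / 2)) as [P|P].
    - destruct (Req_dec (b / 2) 0) as [->|P']; [rewrite sin_0; apply Rle_refl|].
      pose proof (sin_lt_x (b / 2) ltac:(lra)).
      destruct (Rle_lt_dec (b / 2) 1) as [Q|Q].
      + pose proof (sin_ge_0 (b / 2) P ltac:(pose proof PI2_1; lra)). rewrite !Rabs_pos_eq; lra.
      + pose proof (SIN_bound (b / 2)). rewrite (Rabs_pos_eq (b / 2)) by lra. apply Rabs_le; lra.
    - pose proof (sin_lt_x (- (b / 2)) ltac:(lra)) as E. rewrite sin_neg in E.
      destruct (Rle_lt_dec (-1) (b / 2)) as [Q|Q].
      + pose proof (sin_ge_0 (- (b / 2)) ltac:(lra) ltac:(pose proof PI2_1; lra)) as E2.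
        rewrite sin_neg in E2. rewrite !Rabs_left1; lra.
      + pose proof (SIN_bound (b / 2)). rewrite (Rabs_left1 (b / 2)) by lra. apply Rabs_le; lra. }
  apply (fun h => Rsqr_le_abs_1 _ _ h) in S. rewrite !Rsqr_pow2 in S.
  pose proof (pow2_ge_0 (sin (b / 2))). lra.
Qed.

Lemma sin_bound_sqr b : (Rabs (sin b - b) <= b ^ 2)%R.
Proof.
  destruct (MVT_gen (fun t => sin t - t)%R 0 b (fun t => cos t - 1)%R) as [c [Hc E]].
  - intros t _. auto_derive; [easy | ring].
  - intros t _. apply derivable_continuous_pt. apply derivable_pt_minus;
      [apply derivable_pt_sin | apply derivable_pt_id].
  - rewrite sin_0 in E. replace (sin b - b)%R with ((cos c - 1) * (b - 0))%R by lra.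
    rewrite Rabs_mult, Rminus_0_r.
    assert (Hcb : (Rabs c <= Rabs b)%R).
    { revert Hc. unfold Rmin, Rmax. destruct (Rle_dec 0 b); intros; split_Rabs; lra. }
    pose proof (cos_bound c) as [C1 C2]. pose proof (COS_bound c) as [C3 C4].
    assert (Rabs (cos c - 1) <= Rabs c)%R.
    { rewrite Rabs_left1 by lra. rewrite <- pow2_abs in C2.
      pose proof (Rabs_pos c). destruct (Rle_lt_dec (Rabs c) 2); [|lra].
      assert (Rabs c * Rabs c <= Rabs c * 2)%R by (apply Rmult_le_compat_l; lra).
      simpl in C2. lra. }
    rewrite <- pow2_abs. pose proof (Rabs_pos b). nra.
Qed.

(** The upper bound comes from exp(-a) >= 1 - a, that is exp(a) (1 - a) <= 1. *)
Lemma exp_bound a : (Rabs a <= 1 / 2)%R -> (0 <= exp a - 1 - a <= 2 * a ^ 2)%R.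
Proof.
  intros Ha. apply Rabs_le_between in Ha.
  pose proof (exp_ineq1_le a). pose proof (exp_ineq1_le (- a)) as H'.
  rewrite exp_Ropp in H'. split; [lra|].
  assert (E : (exp a * (1 - a) <= 1)%R).
  { pose proof (exp_pos a). replace 1%R with (exp a * / exp a)%R at 2 by (field; lra).
    apply Rmult_le_compat_l; lra. }
  nra.
Qed.

Lemma Cexp_bound w : (Cmod w <= 1 / 2)%R -> (Cmod (Cexp w - 1 - w) <= 4 * Cmod w ^ 2)%R.
Proof.
  intros Hw. rewrite Cmod2_alt.
  pose proof (re_le_Cmod w) as Ha; pose proof (Im_le_Cmod w) as Hb.
  destruct w as [a b]; simpl Re in *; simpl Im in *.
  assert (Ha' : (Rabs a <= 1 / 2)%R) by lra.
  destruct (exp_bound a Ha') as [E1 E2]. destruct (cos_bound b) as [C1 C2].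
  pose proof (sin_bound_sqr b) as S. pose proof (COS_bound b) as [C3 C4]. pose proof (SIN_bound b) as [S3 S4].
  apply Rabs_le_between in Ha'.
  eapply Rle_trans; [apply Cmod_le_Re_Im|]. unfold Cexp. simpl.
  (* The budget 4(a^2 + b^2) is split between the real and the imaginary part; in the latter the
     cross term 3|a||b| is absorbed by the squares. *)
  apply Rle_trans with ((2 * a ^ 2 + b ^ 2) + (2 * a ^ 2 + 3 * b ^ 2))%R; [|simpl; nra].
  apply Rplus_le_compat.
  - replace (_ + _)%R with ((exp a - 1 - a) * cos b - (1 + a) * (1 - cos b))%R by ring.
    pose proof (pow2_ge_0 a); pose proof (pow2_ge_0 b).
    apply Rabs_le; split; nra.
  - replace (_ + _)%R with ((exp a - 1) * (sin b) + (sin b - b))%R by ring.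
    eapply Rle_trans; [apply Rabs_triang|]. rewrite Rabs_mult.
    assert (Rabs (exp a - 1) <= 2 * Rabs a)%R by (apply Rabs_le; split_Rabs; nra).
    assert (Sb : (Rabs (sin b) <= 3 / 2 * Rabs b)%R).
    { apply Rabs_le_between in S. rewrite <- pow2_abs in S.
      assert (Rabs b <= 1 / 2)%R by lra.  pose proof (Rabs_pos b). apply Rabs_le; split_Rabs; nra. }
    assert (Rabs (exp a - 1) * Rabs (sin b) <= (2 * Rabs a) * (3 / 2 * Rabs b))%R.
    { apply Rmult_le_compat; auto using Rabs_pos. }
    rewrite <- (pow2_abs a), <- (pow2_abs b). rewrite <- (pow2_abs b) in S.
    pose proof (pow2_ge_0 (Rabs a - Rabs b)). nra.
Qed.

(** Both follow from 1/(n+1) <= ln((n+1)/n) <= 1/n, which is exp t >= 1 + t at t = -1/(n+1) and at t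
    = 1/n. *)
Lemma ln_ratio_bound n : (1 <= n)%nat ->
  (0 <= (INR n + 1) * (ln (INR (S n)) - ln (INR n)) - 1 <= / INR n)%R /\
  (0 <= ln (INR (S n)) - ln (INR n) <= / INR n)%R.
Proof.
  intros Hn. assert (P : (1 <= INR n)%R) by (apply (le_INR 1); auto).
  rewrite S_INR, <- ln_div by lra.
  assert (U : (ln ((INR n + 1) / INR n) <= / INR n)%R).
  { rewrite <- (ln_exp (/ INR n)). apply ln_le; [apply Rdiv_lt_0_compat; lra|].
    replace ((INR n + 1) / INR n)%R with (1 + / INR n)%R by (field; lra). apply exp_ineq1_le. }
  assert (L : (/ (INR n + 1) <= ln ((INR n + 1) / INR n))%R).
  { replace ((INR n + 1) / INR n)%R with (/ (INR n / (INR n + 1)))%R by (field; lra).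
    rewrite ln_Rinv by (apply Rdiv_lt_0_compat; lra).
    apply Ropp_le_cancel. rewrite Ropp_involutive. rewrite <- (ln_exp (- / (INR n + 1))).
    apply ln_le; [apply Rdiv_lt_0_compat; lra|].
    replace (INR n / (INR n + 1))%R with (1 + - / (INR n + 1))%R by (field; lra). apply exp_ineq1_le. }
  assert (0 < / (INR n + 1))%R by (apply Rinv_0_lt_compat; lra).
  pose proof (Rmult_le_compat_l (INR n + 1) _ _ ltac:(lra) L) as L'.
  rewrite Rinv_r in L' by lra.
  pose proof (Rmult_le_compat_l (INR n + 1) _ _ ltac:(lra) U) as U'.
  replace ((INR n + 1) * / INR n)%R with (1 + / INR n)%R in U' by (field; lra).
  repeat split; lra.
Qed.

(** * Euler's approximants to Gamma and their logarithmic derivatives *)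

Definition nonpole (z : C) : Prop := forall j : nat, z + INR j <> 0.

Definition eulerG (n : nat) (z : C) : C :=
  INR (fact n) * Cexp (z * ln (INR n)) / Cprod (fun j => z + INR j) (n + 1).

(** The logarithmic derivative of [eulerG n]; its limit will be [digamma z]. *)
Definition eulerD (n : nat) (z : C) : C :=
  ln (INR n) - Csum (fun j => / (z + INR j)) (n + 1).

(** Valid at zero as well, because [Rinv_mult] is unconditional. [is_derive_ext] can therefore use
    it along a whole horizontal line, poles included. *)
Lemma Cinv_mult_total x y : / (x * y) = / x * / y.
Proof.
  destruct x as [a b], y as [c d]. unfold Cinv, Cmult; cbn [fst snd].
  replace ((a * c - b * d) ^ 2 + (a * d + b * c) ^ 2)%R
    with ((a ^ 2 + b ^ 2) * (c ^ 2 + d ^ 2))%R by ring.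
  unfold Rdiv. rewrite Rinv_mult. f_equal; ring.
Qed.

Lemma Cprod_nonzero (f : nat -> C) n : (forall j, f j <> 0) -> Cprod f n <> 0.
Proof.
  intros H; induction n as [|n IH]; simpl; [apply C1_nz | now apply Cmult_neq_0].
Qed.

Lemma Cexp_nonzero w : Cexp w <> 0.
Proof.
  intros E. unfold Cexp, RtoC in E. injection E as E1 E2.
  pose proof (exp_pos (Re w)). pose proof (sin2_cos2 (Im w)) as S. unfold Rsqr in S.
  apply Rmult_integral in E1 as [E1|E1]; apply Rmult_integral in E2 as [E2|E2]; nra.
Qed.

Lemma Cexp_plus v w : Cexp (v + w) = Cexp v * Cexp w.
Proof.
  destruct v as [a b], w as [c d]; unfold Cexp, Cmult; simpl.
  rewrite exp_plus, cos_plus, sin_plus; f_equal; ring.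
Qed.

Lemma eulerG_nonzero n z : nonpole z -> eulerG n z <> 0.
Proof.
  intros H. unfold eulerG, Cdiv. apply Cmult_neq_0; [apply Cmult_neq_0|].
  - apply fact_C_neq_0.
  - apply Cexp_nonzero.
  - intros E.
    assert (P := Cprod_nonzero (fun j => z + INR j) (n + 1) H).
    apply C1_nz. rewrite <- (Cinv_r _ P), E. ring.
Qed.

Lemma is_hderive_eulerG n z : nonpole z -> is_hderive (eulerG n) z (eulerG n z * eulerD n z).
Proof.
  intros Hz. unfold eulerG, eulerD.
  assert (P : forall m, is_hderive (fun w => / Cprod (fun j => w + INR j) m) z
     (- / Cprod (fun j => z + INR j) m * Csum (fun j => / (z + INR j)) m)).
  { induction m as [|m IH]; cbn [Cprod Csum].
    - replace (- / 1 * 0) with (RtoC 0) by ring. apply is_hderive_const.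
    - pose proof (is_hderive_mult _ _ _ _ _ IH (is_hderive_inv z (INR m) (Hz m))) as H.
      assert (Pm := Cprod_nonzero (fun j => z + INR j) m Hz). specialize (Hz m).
      replace (- / (Cprod (fun j => z + INR j) m * (z + INR m)) *
               (Csum (fun j => / (z + INR j)) m + / (z + INR m))) with
        (- / Cprod (fun j : nat => z + INR j) m * Csum (fun j : nat => / (z + INR j)) m * / (z + INR m)
         + / Cprod (fun j : nat => z + INR j) m * - / ((z + INR m) * (z + INR m))) by (field; auto).
      destruct H as [H1 H2]; split.
      + eapply is_derive_ext; [|exact H1]. intros t; cbv beta.
        now rewrite Cinv_mult_total.
      + eapply is_derive_ext; [|exact H2]. intros t; cbv beta.
        now rewrite Cinv_mult_total. }
  pose proof (is_hderive_mult _ _ _ _ _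
    (is_hderive_mult _ _ _ _ _ (is_hderive_const (INR (fact n)) z) (is_hderive_Cexp (ln (INR n)) z))
    (P (n + 1)%nat)) as H.
  replace (_ * (_ - _)) with
   ((0 * Cexp (z * ln (INR n)) + INR (fact n) * (ln (INR n) * Cexp (z * ln (INR n)))) *
       / Cprod (fun j : nat => z + INR j) (n + 1) +
       INR (fact n) * Cexp (z * ln (INR n)) *
       (- / Cprod (fun j : nat => z + INR j) (n + 1) * Csum (fun j : nat => / (z + INR j)) (n + 1)))
   by (unfold Cdiv; ring).
  exact H.
Qed.

(** Supplies local boundedness of [eulerD] and the continuity of derivatives required to
    differentiate a limit. *)
Lemma ex_hderive_eulerD n z : nonpole z -> exists l, is_hderive (eulerD n) z l.
Proof.
  intros Hz.
  assert (P : forall m, exists l, is_hderive (fun w => - Csum (fun j => / (w + INR j)) m) z l).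
  { induction m as [|m [l IH]]; cbn [Csum].
    - exists 0. replace (- 0) with (RtoC 0) by ring. apply is_hderive_const.
    - exists (l + (0 * / (z + INR m) + - (1) * (- / ((z + INR m) * (z + INR m))))).
      pose proof (is_hderive_plus _ _ _ _ _ IH (is_hderive_mult _ _ _ _ _
         (is_hderive_const (- (1)) z) (is_hderive_inv z (INR m) (Hz m)))) as [H1 H2].
      split; [eapply is_derive_ext; [|exact H1] | eapply is_derive_ext; [|exact H2]];
        intros t; cbv beta; f_equal; ring. }
  destruct (P (n + 1)%nat) as [l H]. exists (0 + l).
  apply (is_hderive_plus _ _ _ _ _ (is_hderive_const (ln (INR n)) z) H).
Qed.

Lemma Cmod_div_bound a d (A x : R) : (0 < x)%R -> (Cmod a <= A / x)%R -> (x / 2 <= Cmod d)%R ->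
  (Cmod (a / d) <= 2 * A / x ^ 2)%R.
Proof.
  intros Hx Ha Hd.
  assert (D : d <> 0) by (apply Cmod_gt_0; lra).
  rewrite Cmod_div by auto.
  replace (2 * A / x ^ 2)%R with ((A / x) * / (x / 2))%R by (field; lra).
  apply Rmult_le_compat; [apply Cmod_ge_0 | | assumption |].
  - apply Rlt_le, Rinv_0_lt_compat. lra.
  - apply Rinv_le_contravar; lra.
Qed.

Lemma denominator_bound (b : R) n z : (Cmod z <= b)%R -> (2 * b <= INR n)%R ->
  (INR n / 2 <= Cmod (z + INR (S n)))%R.
Proof.
  intros Hz Hn. pose proof (Cmod_minus_le (INR (S n)) (- z)) as H.
  rewrite Cmod_opp, Cmod_R, Rabs_pos_eq in H by apply pos_INR.
  replace (INR (S n) - - z) with (z + INR (S n)) in H by ring.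
  rewrite S_INR in *. lra.
Qed.

(** With l = ln((n+1)/n), the ratio of consecutive terms is (n+1) exp(zl) / (z+n+1). Subtracting 1
    leaves a numerator of size O(1/n), by [ln_ratio_bound] and [Cexp_bound], over a denominator of
    modulus at least n/2. *)
Lemma eulerG_step (b : R) n z :
  (1 <= b)%R -> (Cmod z <= b)%R -> (2 * b <= INR n)%R -> nonpole z ->
  (Cmod (eulerG (S n) z - eulerG n z) <= Cmod (eulerG n z) * (18 * b ^ 2 / INR n ^ 2))%R.
Proof.
  intros Hb Hz Hn Hp.
  assert (n1 : (1 <= n)%nat) by (apply INR_le; simpl; lra).
  destruct (ln_ratio_bound n n1) as [[L1 L2] [L3 L4]].
  set (l := (ln (INR (S n)) - ln (INR n))%R) in *.
  assert (E : eulerG (S n) z - eulerG n z = eulerG n z *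
     ((z * ((INR n + 1) * l - 1)%R + (INR n + 1)%R * (Cexp (z * l) - 1 - z * l)) / (z + INR (S n)))).
  { unfold eulerG. rewrite !Nat.add_1_r. cbn [Cprod]. rewrite fact_C_S.
    replace (z * ln (INR (S n))) with (z * ln (INR n) + z * l)
      by (unfold l; rewrite RtoC_minus; ring).
    rewrite Cexp_plus, RtoC_minus, RtoC_mult, RtoC_plus, RtoC_S.
    pose proof (Hp n); pose proof (Hp (S n)) as Hs. rewrite RtoC_S in Hs.
    pose proof (Cprod_nonzero (fun j => z + INR j) n Hp).
    field. auto. }
  rewrite E, Cmod_mult. apply Rmult_le_compat_l; [apply Cmod_ge_0|].
  (* The numerator is at most (b + 8b^2)/n <= 9b^2/n, and dividing by at least n/2 doubles the
     constant. *)
  replace (18 * b ^ 2)%R with (2 * (9 * b ^ 2))%R by ring.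
  apply Cmod_div_bound; [lra | | eapply denominator_bound; eauto].
  assert (P : (0 < / INR n)%R) by (apply Rinv_0_lt_compat; lra).
  assert (W : (Cmod (z * l) <= b * / INR n)%R).
  { rewrite Cmod_mult, Cmod_R, Rabs_pos_eq by auto.
    apply Rmult_le_compat; auto using Cmod_ge_0. }
  assert (W2 : (b * / INR n <= 1 / 2)%R).
  { apply Rmult_le_reg_r with (INR n); [lra|]. rewrite Rmult_assoc, Rinv_l; lra. }
  assert (X := Cexp_bound (z * l) ltac:(lra)).
  assert (W3 : (Cmod (z * l) ^ 2 <= (b * / INR n) ^ 2)%R)
    by (apply pow_incr; split; [apply Cmod_ge_0 | auto]).
  eapply Rle_trans; [apply Cmod_triangle|]. rewrite !Cmod_mult, !Cmod_R.
  rewrite (Rabs_pos_eq (INR n + 1)), (Rabs_pos_eq ((INR n + 1) * l - 1)) by lra.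
  apply Rle_trans with (b * / INR n + (2 * INR n) * (4 * (b * / INR n) ^ 2))%R.
  - apply Rplus_le_compat.
    + apply Rmult_le_compat; auto using Cmod_ge_0.
    + apply Rmult_le_compat; [lra | apply Cmod_ge_0 | lra | lra].
  - replace (b * / INR n + 2 * INR n * (4 * (b * / INR n) ^ 2))%R
      with ((b + 8 * b ^ 2) * / INR n)%R by (field; lra).
    apply Rmult_le_compat_r; nra.
Qed.

(** The increment is l - 1/(z+n+1). The constant is the one of [eulerG_step], so that one choice
    serves both sequences. *)
Lemma eulerD_step (b : R) n z :
  (1 <= b)%R -> (Cmod z <= b)%R -> (2 * b <= INR n)%R -> nonpole z ->
  (Cmod (eulerD (S n) z - eulerD n z) <= 18 * b ^ 2 / INR n ^ 2)%R.
Proof.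
  intros Hb Hz Hn Hp.
  assert (n1 : (1 <= n)%nat) by (apply INR_le; simpl; lra).
  destruct (ln_ratio_bound n n1) as [[L1 L2] [L3 L4]].
  set (l := (ln (INR (S n)) - ln (INR n))%R) in *.
  assert (E : eulerD (S n) z - eulerD n z =
     (((INR n + 1) * l - 1)%R + z * l) / (z + INR (S n))).
  { unfold eulerD. rewrite !Nat.add_1_r. cbn [Csum].
    pose proof (Hp (S n)) as Hs. rewrite RtoC_S in *.
    replace (RtoC (ln (INR (S n)))) with (ln (INR n) + l)
      by (unfold l; rewrite RtoC_minus; ring).
    rewrite RtoC_minus, RtoC_mult, RtoC_plus. set (s := Csum _ n). set (q := / (z + INR n)).
    field. auto. }
  rewrite E.
  assert (P : (0 < / INR n)%R) by (apply Rinv_0_lt_compat; lra).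
  replace (18 * b ^ 2)%R with (2 * (9 * b ^ 2))%R by ring.
  apply Cmod_div_bound; [lra | | eapply denominator_bound; eauto].
  eapply Rle_trans; [apply Cmod_triangle|]. rewrite Cmod_mult, !Cmod_R, !Rabs_pos_eq by lra.
  apply Rle_trans with (/ INR n + b * / INR n)%R.
  - apply Rplus_le_compat; [lra | apply Rmult_le_compat; auto using Cmod_ge_0].
  - replace (/ INR n + b * / INR n)%R with ((1 + b) * / INR n)%R by ring.
    apply Rmult_le_compat_r; nra.
Qed.

(** * Increments of order 1/n^2, isolation of poles and local bounds *)

Lemma inv_sqr_telescope n : (2 <= n)%nat ->
  (0 < / INR n ^ 2 <= / (INR n - 1) - / (INR (S n) - 1))%R.
Proof.
  intros Hn. assert (P : (2 <= INR n)%R) by (apply (le_INR 2); auto).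
  rewrite S_INR. split; [apply Rinv_0_lt_compat; nra|].
  replace (/ (INR n - 1) - / (INR n + 1 - 1))%R with (/ ((INR n - 1) * INR n))%R by (field; lra).
  apply Rinv_le_contravar; nra.
Qed.

Lemma summable_increments (u : nat -> C) (k : R) N : (2 <= N)%nat -> (0 <= k)%R ->
  (forall n, (N <= n)%nat -> (Cmod (u (S n) - u n) <= k / INR n ^ 2)%R) ->
  forall m, (Cmod (u (N + m)%nat - u N) <= k * (/ (INR N - 1) - / (INR (N + m) - 1)))%R.
Proof.
  intros HN Hk H m. induction m as [|m IH].
  - rewrite Nat.add_0_r. replace (u N - u N) with (RtoC 0) by ring. rewrite Cmod_0. lra.
  - rewrite Nat.add_succ_r.
    replace (u (S (N + m)) - u N) with ((u (S (N + m)) - u (N + m)%nat) + (u (N + m)%nat - u N)) by ring.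
    eapply Rle_trans; [apply Cmod_triangle|].
    specialize (H (N + m)%nat ltac:(lia)).
    pose proof (inv_sqr_telescope (N + m)%nat ltac:(lia)) as [T1 T2].
    apply (Rmult_le_compat_l k) in T2; [|auto]. unfold Rdiv in H. lra.
Qed.

Lemma inv_pred_pos n : (2 <= n)%nat -> (0 < / (INR n - 1))%R.
Proof. intros Hn. apply le_INR in Hn. simpl in Hn. apply Rinv_0_lt_compat. lra. Qed.

(** A bootstrap: while u stays within |u N|/2 of u N, its modulus is at most 2|u N|, so the
    increments telescope to at most 2k|u N|/(N-1) <= |u N|/2. This bounds u from above and keeps it
    away from 0. *)
Lemma relative_increments (u : nat -> C) (k : R) N : (2 <= N)%nat -> (0 <= k)%R -> (4 * k <= INR N - 1)%R ->
  (forall n, (N <= n)%nat -> (Cmod (u (S n) - u n) <= Cmod (u n) * (k / INR n ^ 2))%R) ->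
  forall n, (N <= n)%nat -> (Cmod (u n - u N) <= Cmod (u N) / 2)%R.
Proof.
  intros HN Hk HkN H n Hn.
  assert (PN : (2 <= INR N)%R) by (apply (le_INR 2); auto).
  assert (S : (2 * k * / (INR N - 1) <= 1 / 2)%R).
  { apply Rmult_le_reg_r with (INR N - 1)%R; [lra|]. rewrite Rmult_assoc, Rinv_l; lra. }
  pose proof (Cmod_ge_0 (u N)) as P0.
  assert (B : forall m, (N <= m)%nat ->
    (Cmod (u N) * (2 * k * (/ (INR N - 1) - / (INR m - 1))) <= Cmod (u N) * (1 / 2))%R).
  { intros m Hm. pose proof (inv_pred_pos m ltac:(lia)).
    apply Rmult_le_compat_l; [assumption|]. nra. }
  (* The induction carries the sharper telescoped bound; [B] recovers the half at each index. *)
  assert (Q : (Cmod (u n - u N) <= Cmod (u N) * (2 * k * (/ (INR N - 1) - / (INR n - 1))))%R).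
  { induction Hn as [|n Hn IH].
    - replace (u N - u N) with (RtoC 0) by ring. rewrite Cmod_0. lra.
    - pose proof (inv_sqr_telescope n ltac:(lia)) as [T1 T2].
      replace (u (Datatypes.S n) - u N) with ((u (Datatypes.S n) - u n) + (u n - u N)) by ring.
      eapply Rle_trans; [apply Cmod_triangle|].
      specialize (H n Hn).
      assert (Cmod (u n) <= 2 * Cmod (u N))%R
        by (pose proof (Cmod_minus_le (u n) (u N)); pose proof (B n Hn); lra).
      assert (Cmod (u n) * (k / INR n ^ 2) <= 2 * Cmod (u N) * (k / INR n ^ 2))%R.
      { apply Rmult_le_compat_r; [|assumption]. unfold Rdiv. apply Rmult_le_pos; lra. }
      apply (Rmult_le_compat_l (2 * Cmod (u N) * k)) in T2; [|apply Rmult_le_pos; lra].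
      unfold Rdiv in *. lra. }
  pose proof (B n Hn). lra.
Qed.

(** Near a, only finitely many j can satisfy z = -j; they are avoided one at a time by shrinking the
    radius. The centre is excluded since it may itself be a pole. *)
Lemma poles_isolated (a : C) : exists eps : posreal,
  forall z, (Cmod (z - a) < eps)%R -> z <> a -> nonpole z.
Proof.
  assert (F : forall m, exists eps : posreal, forall z, (Cmod (z - a) < eps)%R -> z <> a ->
     forall j, (j < m)%nat -> z + INR j <> 0).
  { induction m as [|m [eps IH]].
    - exists (mkposreal 1 Rlt_0_1). intros; lia.
    - destruct (Ceq_dec (a + INR m) 0) as [E|E].
      + exists eps. intros z Hz Hne j Hj Hz0.
        destruct (Nat.eq_dec j m) as [->|]; [|apply (IH z Hz Hne j); auto; lia].
        apply Hne. replace z with (z + INR m - INR m) by ring. rewrite Hz0, <- E. ring.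
      + assert (Pm : (0 < Rmin eps (Cmod (a + INR m)))%R)
          by (apply Rmin_glb_lt; [apply cond_pos | now apply Cmod_gt_0]).
        exists (mkposreal _ Pm). simpl. intros z Hz Hne j Hj Hz0.
        destruct (Nat.eq_dec j m) as [->|].
        * pose proof (Rmin_r eps (Cmod (a + INR m))).
          replace (z - a) with (- (a + INR m)) in Hz
            by (replace (z - a) with (z + INR m - (a + INR m)) by ring; rewrite Hz0; ring).
          rewrite Cmod_opp in Hz. lra.
        * pose proof (Rmin_l eps (Cmod (a + INR m))). apply (IH z ltac:(lra) Hne j); auto; lia. }
  (* Within distance 1 of a, z = -j forces j < |a| + 1 < m + 1. *)
  destruct (nfloor_ex (Cmod a + 1)) as [m [_ Hm]]; [pose proof (Cmod_ge_0 a); lra|].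
  destruct (F (S m)) as [eps H].
  assert (P : (0 < Rmin eps 1)%R) by (apply Rmin_glb_lt; [apply cond_pos | lra]).
  exists (mkposreal _ P). simpl. intros z Hz Hne j Hj.
  pose proof (Rmin_l eps 1); pose proof (Rmin_r eps 1).
  destruct (Nat.lt_ge_cases j (S m)) as [L|L]; [apply (H z ltac:(lra) Hne j); auto|].
  apply le_INR in L. rewrite S_INR in L.
  assert (Cmod z = INR j).
  { replace z with (- RtoC (INR j))
      by (replace (- RtoC (INR j)) with (z - (z + INR j)) by ring; rewrite Hj; ring).
    rewrite Cmod_opp, Cmod_R, Rabs_pos_eq; auto using pos_INR. }
  pose proof (Cmod_minus_le z a). lra.
Qed.

Lemma is_hderive_locally_bounded f z l : is_hderive f z l ->
  exists (eps : posreal) (b : R), forall t, (Rabs (t - Re z) < eps)%R -> (Cmod (f (t, Im z)) <= b)%R.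
Proof.
  intros [H1 H2].
  assert (Q : forall (g : R -> R) x m, is_derive g x m ->
    locally x (fun t => Rabs (g t) <= Rabs (g x) + 1)%R).
  { intros g x m Hg.
    assert (C : continuous g x) by (apply (ex_derive_continuous g x); now exists m).
    specialize (C _ (locally_ball (g x) (mkposreal 1 Rlt_0_1))).
    unfold filtermap in C. revert C; apply filter_imp; intros t Ht.
    change (Rabs (g t - g x) < 1)%R in Ht. split_Rabs; lra. }
  destruct (filter_and _ _ (Q _ _ _ H1) (Q _ _ _ H2)) as [eps He].
  exists eps. eexists. intros t Ht. specialize (He t Ht).
  eapply Rle_trans; [apply Cmod_le_Re_Im|]. apply Rplus_le_compat; apply He.
Qed.

(** * The digamma recursion *)

(** Real parts of a horizontal segment through z: the open connected real domain on which
    [CVU_Derive] is applied. *)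
Definition hline (z : C) (eps : R) (t : R) : Prop := (Rabs (t - Re z) < eps)%R.

Lemma hline_open z eps : open (hline z eps).
Proof.
  intros t Ht. unfold hline in Ht. assert (P : (0 < eps - Rabs (t - Re z))%R) by lra.
  exists (mkposreal _ P). intros s Hs. change (Rabs (s - t) < eps - Rabs (t - Re z))%R in Hs.
  unfold hline. split_Rabs; lra.
Qed.

Lemma hline_connected z eps : is_connected (hline z eps).
Proof. intros a b t Ha Hb Ht. unfold hline in *. split_Rabs; lra. Qed.

Definition unif_summable (F : nat -> C -> C) (N : nat) (k : R) (z : C) (eps : R) : Prop :=
  forall t n, hline z eps t -> (N <= n)%nat ->
    (Cmod (F (S n) (t, Im z) - F n (t, Im z)) <= k / INR n ^ 2)%R.

Lemma unif_summable_cauchy F N k z eps : (2 <= N)%nat -> (0 <= k)%R ->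
  unif_summable F N k z eps ->
  forall d : posreal, exists N', forall n m t, hline z eps t -> (N' <= n)%nat -> (N' <= m)%nat ->
    (Cmod (F n (t, Im z) - F m (t, Im z)) < d)%R.
Proof.
  intros HN Hk H d.
  (* The tail beyond N' is at most k/(N'-1), and N' - 1 >= m0 + 1 > 2k/d makes it less than d/2. *)
  destruct (nfloor_ex (2 * k / d)) as [m0 [_ Hm0]].
  { apply Rdiv_le_0_compat; [lra | apply cond_pos]. }
  exists (N + S (S m0))%nat. set (N' := (N + S (S m0))%nat).
  assert (Q : forall n t, hline z eps t -> (N' <= n)%nat ->
      (Cmod (F n (t, Im z) - F N' (t, Im z)) < d / 2)%R).
  { intros n t Ht Hn.
    pose proof (summable_increments (fun n => F n (t, Im z)) k N' ltac:(lia) Hk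
      (fun n Hn => H t n Ht ltac:(lia)) (n - N')%nat) as E.
    replace (N' + (n - N'))%nat with n in E by lia.
    eapply Rle_lt_trans; [exact E|].
    pose proof (inv_pred_pos n ltac:(lia)) as Pn.
    apply Rle_lt_trans with (k * / (INR N' - 1))%R; [nra|].
    assert (L : (INR m0 + 1 <= INR N' - 1)%R).
    { assert (L := le_INR (S (S m0)) N' ltac:(lia)). rewrite !S_INR in L. lra. }
    pose proof (cond_pos d) as Pd. pose proof (pos_INR m0).
    apply Rmult_lt_reg_r with (INR N' - 1)%R; [lra|].
    rewrite Rmult_assoc, Rinv_l by lra.
    assert (2 * k < d * (INR N' - 1))%R; [|lra].
    apply Rle_lt_trans with (d * (2 * k / d))%R; [right; field; lra|].
    apply Rmult_lt_compat_l; lra. }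
  intros n m t Ht Hn Hm. pose proof (Q n t Ht Hn) as Q1. pose proof (Q m t Ht Hm) as Q2.
  rewrite Cmod_minus_sym in Q2.
  replace (F n (t, Im z) - F m (t, Im z)) with
    ((F n (t, Im z) - F N' (t, Im z)) + (F N' (t, Im z) - F m (t, Im z))) by ring.
  eapply Rle_lt_trans; [apply Cmod_triangle | lra].
Qed.

Lemma unif_summable_CVU F N k z eps : (2 <= N)%nat -> (0 <= k)%R ->
  unif_summable F N k z eps ->
  CVU_dom (fun n t => Re (F n (t, Im z))) (hline z eps) /\
  CVU_dom (fun n t => Im (F n (t, Im z))) (hline z eps).
Proof.
  intros HN Hk H. split; apply CVU_dom_cauchy; intros d;
    destruct (unif_summable_cauchy F N k z eps HN Hk H d) as [N' HN'];
    exists N'; intros n m t Ht Hn Hm; (eapply Rle_lt_trans; [|apply (HN' n m t Ht Hn Hm)]).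
  - apply (re_le_Cmod (F n (t, Im z) - F m (t, Im z))).
  - apply (Im_le_Cmod (F n (t, Im z) - F m (t, Im z))).
Qed.

Lemma unif_summable_lim F N k z (eps : posreal) : (2 <= N)%nat -> (0 <= k)%R ->
  unif_summable F N k z eps -> is_limC (fun n => F n z) (C_lim_seq (fun n => F n z)).
Proof.
  intros HN Hk H.
  assert (Hz : hline z eps (Re z)).
  { unfold hline. rewrite Rminus_diag, Rabs_R0. apply cond_pos. }
  pose proof (unif_summable_cauchy F N k z eps HN Hk H) as Q.
  assert (Ez : (Re z, Im z) = z) by now destruct z.
  split; simpl; apply Lim_seq_correct', ex_lim_seq_cauchy_corr; intros d;
    destruct (Q d) as [N' HN']; exists N'; intros n m Hn Hm;
    specialize (HN' n m (Re z) Hz Hn Hm); rewrite Ez in HN';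
    (eapply Rle_lt_trans; [|apply HN']).
  - apply (re_le_Cmod (F n z - F m z)).
  - apply (Im_le_Cmod (F n z - F m z)).
Qed.

(** Limit and derivative are interchanged by uniform convergence of both sequences, for real and
    imaginary parts separately; [Q] treats the two at once. *)
Lemma is_hderive_lim F F' N k z (eps : posreal) : (2 <= N)%nat -> (0 <= k)%R ->
  unif_summable F N k z eps -> unif_summable F' N k z eps ->
  (forall n t, hline z eps t -> is_hderive (F n) (t, Im z) (F' n (t, Im z))) ->
  (forall n t, hline z eps t -> exists l, is_hderive (F' n) (t, Im z) l) ->
  is_hderive (fun w => C_lim_seq (fun n => F n w)) z (C_lim_seq (fun n => F' n z)).
Proof.
  intros HN Hk H H' HF HF'.
  destruct (unif_summable_CVU F N k z eps HN Hk H) as [U1 U2].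
  destruct (unif_summable_CVU F' N k z eps HN Hk H') as [V1 V2].
  assert (Hz : hline z eps (Re z)).
  { unfold hline. rewrite Rminus_diag, Rabs_R0. apply cond_pos. }
  assert (Ez : (Re z, Im z) = z) by now destruct z.
  assert (Q : forall p : C -> R,
    CVU_dom (fun n t => p (F n (t, Im z))) (hline z eps) ->
    CVU_dom (fun n t => p (F' n (t, Im z))) (hline z eps) ->
    (forall n t, hline z eps t -> is_derive (fun s => p (F n (s, Im z))) t (p (F' n (t, Im z)))) ->
    (forall n t, hline z eps t -> ex_derive (fun s => p (F' n (s, Im z))) t) ->
    is_derive (fun t => real (Lim_seq (fun n => p (F n (t, Im z))))) (Re z)
      (real (Lim_seq (fun n => p (F' n z))))).
  { intros p C1 C2 D1 D2.
    assert (E : forall n t, hline z eps t ->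
       Derive (fun s => p (F n (s, Im z))) t = p (F' n (t, Im z)))
      by (intros; apply is_derive_unique, D1; auto).
    rewrite (Lim_seq_ext (fun n => p (F' n z)) (fun n => Derive (fun s => p (F n (s, Im z))) (Re z)))
      by (intros n; rewrite E, Ez; auto).
    apply (CVU_Derive (fun n t => p (F n (t, Im z))) (hline z eps)); auto.
    - apply hline_open.
    - apply hline_connected.
    - intros n t Ht. eexists; apply D1, Ht.
    - intros n t Ht. apply continuity_pt_ext_loc with (fun s => p (F' n (s, Im z))).
      + generalize (hline_open z eps t Ht). apply filter_imp. intros s Hs. now rewrite E.
      + apply continuity_pt_filterlim. apply (ex_derive_continuous (fun s => p (F' n (s, Im z)))). auto.
    - intros d. specialize (C2 d). revert C2. apply filter_imp. intros n Hn t Ht.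
      rewrite E by auto.
      rewrite (Lim_seq_ext _ (fun n => p (F' n (t, Im z)))) by (intros; apply E, Ht). auto. }
  split; simpl.
  - apply (Q Re U1 V1); intros n t Ht; [apply (HF n t Ht)|].
    destruct (HF' n t Ht) as [l [L _]]. eexists; apply L.
  - apply (Q Im U2 V2); intros n t Ht; [apply (HF n t Ht)|].
    destruct (HF' n t Ht) as [l [_ L]]. eexists; apply L.
Qed.

Lemma Cmult_increment_bound (a b c d : C) (k m x : R) :
  (0 <= m)%R -> (Cmod a <= m)%R -> (Cmod d <= m)%R ->
  (Cmod (a - b) <= k * x)%R -> (Cmod (c - d) <= k * x)%R ->
  (Cmod (a * c - b * d) <= 2 * m * k * x)%R.
Proof.
  intros Hm Ha Hd H1 H2.
  replace (a * c - b * d) with (a * (c - d) + (a - b) * d) by ring.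
  eapply Rle_trans; [apply Cmod_triangle|]. rewrite !Cmod_mult.
  assert (Cmod a * Cmod (c - d) <= m * (k * x))%R by (apply Rmult_le_compat; auto using Cmod_ge_0).
  assert (Cmod (a - b) * Cmod d <= k * x * m)%R by (apply Rmult_le_compat; auto using Cmod_ge_0).
  lra.
Qed.

Lemma digamma_lim z : nonpole z -> is_limC (fun n => eulerD n z) (digamma z).
Proof.
  intros Hz.
  assert (Ez : (Re z, Im z) = z) by now destruct z.
  (* Bounds the modulus on the whole segment, whose radius will be at most 1. *)
  set (b := (Cmod z + 1)%R).
  assert (Hb : (1 <= b)%R) by (unfold b; pose proof (Cmod_ge_0 z); lra).
  set (k := (18 * b ^ 2)%R).
  assert (Hk : (18 * b <= k)%R) by (unfold k; nra).
  (* N - 1 >= 4k is what [relative_increments] asks, and it also gives 2b <= N for the step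
     estimates. *)
  destruct (nfloor_ex (4 * k)) as [N0 [_ HN0]]; [lra|].
  set (N := S (S N0)).
  assert (HN : (4 * k <= INR N - 1)%R) by (unfold N; rewrite !S_INR; lra).
  assert (N2 : (2 <= N)%nat) by (unfold N; lia).
  destruct (poles_isolated z) as [e1 He1].
  (* Local bounds are taken at the index N alone; the increment estimates carry them to all later
     indices. *)
  destruct (is_hderive_locally_bounded _ _ _ (is_hderive_eulerG N z Hz)) as [e2 [mG He2]].
  destruct (ex_hderive_eulerD N z Hz) as [l Hl].
  destruct (is_hderive_locally_bounded _ _ _ Hl) as [e3 [mD He3]].
  assert (P : (0 < Rmin (Rmin e1 e2) (Rmin e3 1))%R)
    by (repeat apply Rmin_glb_lt; try apply cond_pos; lra).
  set (eps := mkposreal _ P).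
  assert (Eps : (eps <= e1 /\ eps <= e2 /\ eps <= e3 /\ eps <= 1)%R).
  { simpl. pose proof (Rmin_l (Rmin e1 e2) (Rmin e3 1)). pose proof (Rmin_r (Rmin e1 e2) (Rmin e3 1)).
    pose proof (Rmin_l e1 e2). pose proof (Rmin_r e1 e2). pose proof (Rmin_l e3 1). pose proof (Rmin_r e3 1).
    lra. }
  destruct Eps as (Ee1 & Ee2 & Ee3 & Ee4). clearbody eps.
  assert (Sm : forall t, hline z eps t -> (Cmod ((t, Im z) - z) < eps)%R).
  { intros t Ht. rewrite <- Ez at 2. eapply Rle_lt_trans; [apply Cmod_pair_le_Re | exact Ht]. }
  assert (Np : forall t, hline z eps t -> nonpole (t, Im z)).
  { intros t Ht. destruct (Ceq_dec (t, Im z) z) as [->|Hne]; [auto|].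
    apply He1; auto. specialize (Sm t Ht). lra. }
  assert (Bd : forall t, hline z eps t -> (Cmod (t, Im z) <= b)%R).
  { intros t Ht. specialize (Sm t Ht). pose proof (Cmod_minus_le (t, Im z) z). unfold b. lra. }
  assert (Sz : forall n, (N <= n)%nat -> (2 * b <= INR n)%R).
  { intros n Hn. apply le_INR in Hn. lra. }
  assert (SG : forall t n, hline z eps t -> (N <= n)%nat ->
     (Cmod (eulerG (S n) (t, Im z) - eulerG n (t, Im z)) <= Cmod (eulerG n (t, Im z)) * (k / INR n ^ 2))%R).
  { intros t n Ht Hn. apply eulerG_step; auto. }
  assert (CG : forall t n, hline z eps t -> (N <= n)%nat ->
     (Cmod (eulerG n (t, Im z) - eulerG N (t, Im z)) <= Cmod (eulerG N (t, Im z)) / 2)%R).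
  { intros t n Ht Hn.
    apply (relative_increments (fun n => eulerG n (t, Im z)) k N); auto; lra. }
  assert (UD : unif_summable eulerD N k z eps).
  { intros t n Ht Hn. apply eulerD_step; auto. }
  (* A common bound for [eulerG] and [eulerD] from N on: these are at most 3mG/2 and mD + k. The
     summand 1 ensures m >= 1, whence k <= mk. *)
  set (m := (2 * mG + mD + 2 * k + 1)%R).
  assert (Hz0 : hline z eps (Re z)).
  { unfold hline. rewrite Rminus_diag, Rabs_R0. apply cond_pos. }
  assert (PG : (0 <= mG)%R).
  { eapply Rle_trans; [apply Cmod_ge_0 | apply (He2 (Re z))]. unfold hline in Hz0; lra. }
  assert (PD : (0 <= mD)%R).
  { eapply Rle_trans; [apply Cmod_ge_0 | apply (He3 (Re z))]. unfold hline in Hz0; lra. }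
  assert (BG : forall t n, hline z eps t -> (N <= n)%nat -> (Cmod (eulerG n (t, Im z)) <= m)%R).
  { intros t n Ht Hn. specialize (CG t n Ht Hn).
    pose proof (Cmod_minus_le (eulerG n (t, Im z)) (eulerG N (t, Im z))).
    assert (Cmod (eulerG N (t, Im z)) <= mG)%R by (apply He2; unfold hline in Ht; lra).
    unfold m. lra. }
  assert (BD : forall t n, hline z eps t -> (N <= n)%nat -> (Cmod (eulerD n (t, Im z)) <= m)%R).
  { intros t n Ht Hn.
    pose proof (summable_increments (fun n => eulerD n (t, Im z)) k N N2 ltac:(lra)
      (fun n Hn => UD t n Ht Hn) (n - N)%nat) as E.
    replace (N + (n - N))%nat with n in E by lia.
    pose proof (Cmod_minus_le (eulerD n (t, Im z)) (eulerD N (t, Im z))).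
    assert (Cmod (eulerD N (t, Im z)) <= mD)%R by (apply He3; unfold hline in Ht; lra).
    pose proof (inv_pred_pos n ltac:(lia)).
    assert (/ (INR N - 1) <= 1)%R by (rewrite <- Rinv_1; apply Rinv_le_contravar; lra).
    unfold m. nra. }
  assert (Pk : forall n, (0 <= / INR n ^ 2)%R).
  { intros n. destruct (Req_dec (INR n ^ 2) 0) as [->|Hn]; [rewrite Rinv_0; lra|].
    apply Rlt_le, Rinv_0_lt_compat. pose proof (pow2_ge_0 (INR n)). lra. }
  assert (Hm1 : (1 <= m)%R) by (unfold m; lra).
  (* Increments of [eulerG] have constant mk, so the product rule for increments gives 2m(mk); k'
     covers the factor and the product alike. *)
  set (k' := (2 * m * (m * k))%R).
  assert (Hkm : (k <= m * k)%R) by nra.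
  assert (Hkk : (m * k <= k')%R) by (unfold k'; nra).
  assert (Hk' : (0 <= k')%R) by lra.
  assert (UG' : forall t n, hline z eps t -> (N <= n)%nat ->
     (Cmod (eulerG (S n) (t, Im z) - eulerG n (t, Im z)) <= m * k * / INR n ^ 2)%R).
  { intros t n Ht Hn. eapply Rle_trans; [apply SG; auto|]. unfold Rdiv. rewrite Rmult_assoc.
    apply Rmult_le_compat_r; [apply Rmult_le_pos; [lra | apply Pk] | auto]. }
  assert (UG : unif_summable eulerG N k' z eps).
  { intros t n Ht Hn. eapply Rle_trans; [apply UG'; auto|].
    apply Rmult_le_compat_r; auto. }
  assert (UGD : unif_summable (fun n w => eulerG n w * eulerD n w) N k' z eps).
  { intros t n Ht Hn. apply Cmult_increment_bound; auto; [lra|].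
    eapply Rle_trans; [apply UD; auto|]. apply Rmult_le_compat_r; auto. }
  assert (LG := unif_summable_lim eulerG N k' z eps N2 Hk' UG).
  assert (LD := unif_summable_lim eulerD N k z eps N2 ltac:(lra) UD).
  (* From N on, the terms keep at least half the modulus of the nonzero [eulerG N z]. *)
  assert (G0 : Gamma z <> 0).
  { apply (is_limC_neq_0 (fun n => eulerG n z) _ N (Cmod (eulerG N z) / 2)%R); [| |exact LG].
    - pose proof (proj1 (Cmod_gt_0 _) (eulerG_nonzero N z Hz)). lra.
    - intros n Hn. specialize (CG (Re z) n Hz0 Hn). rewrite Ez in CG.
      rewrite Cmod_minus_sym in CG. pose proof (Cmod_minus_le (eulerG N z) (eulerG n z)). lra. }
  assert (DG : C_derive Gamma z = Gamma z * C_lim_seq (fun n => eulerD n z)).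
  { change (C_derive Gamma z = C_lim_seq (fun n => eulerG n z) * C_lim_seq (fun n => eulerD n z)).
    rewrite <- (is_limC_unique _ _ (is_limC_mult _ _ _ _ LG LD)).
    apply C_derive_hderive.
    apply (is_hderive_lim eulerG (fun n w => eulerG n w * eulerD n w) N k' z eps); auto.
    - intros n t Ht. apply is_hderive_eulerG; auto.
    - intros n t Ht. destruct (ex_hderive_eulerD n (t, Im z) (Np t Ht)) as [l' Hl'].
      eexists. apply is_hderive_mult; [apply is_hderive_eulerG; auto | exact Hl']. }
  replace (digamma z) with (C_lim_seq (fun n => eulerD n z)); [exact LD|].
  unfold digamma. rewrite DG. field. exact G0.
Qed.

(** The two finite sums overlap: [eulerD n (z + 1) - eulerD n z] is 1/z - 1/(z+n+1), and the last
    term is at most 2/n in modulus once n >= 2|z|. *)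
Lemma digamma_succ z : nonpole z -> digamma (z + 1) = digamma z + / z.
Proof.
  intros Hz.
  assert (Hz1 : nonpole (z + 1)).
  { intros j. specialize (Hz (S j)). rewrite RtoC_S in Hz. intros E; apply Hz. rewrite <- E. ring. }
  assert (Hz0 : z <> 0) by (intros E; apply (Hz 0%nat); rewrite E; simpl; ring).
  pose proof (is_limC_minus _ _ _ _ (digamma_lim _ Hz1) (digamma_lim _ Hz)) as L.
  assert (L' : is_limC (fun n => eulerD n (z + 1) - eulerD n z) (/ z)).
  { destruct (nfloor_ex (2 * Cmod z)) as [N [_ HN]]; [pose proof (Cmod_ge_0 z); lra|].
    apply (is_limC_bound _ _ (S N) 2). intros n Hn. apply le_INR in Hn. rewrite S_INR in Hn.
    replace (eulerD n (z + 1) - eulerD n z - / z) with (- / (z + INR (S n))).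
    2:{ unfold eulerD. rewrite !Nat.add_1_r, (Csum_shift (fun j => / (z + INR j))).
        rewrite (Csum_ext (fun i => / (z + INR (S i))) (fun j => / (z + 1 + INR j)))
          by (intros; rewrite RtoC_S; f_equal; ring).
        cbn [Csum]. change (INR 0) with 0%R. rewrite Cplus_0_r. rewrite RtoC_S.
        replace (z + 1 + INR n) with (z + (INR n + 1)) by ring. ring. }
    pose proof (denominator_bound (Cmod z) n z (Rle_refl _) ltac:(lra)) as B.
    pose proof (Cmod_ge_0 z).
    rewrite Cmod_opp, Cmod_inv by apply Hz.
    replace (2 / INR n)%R with (/ (INR n / 2))%R by (field; lra).
    apply Rinv_le_contravar; lra. }
  apply is_limC_unique in L. apply is_limC_unique in L'.
  rewrite L' in L. rewrite L. ring.
Qed.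

(** * Harmonic differences and entire functions *)

Lemma nonpole_shift z k : nonpole z -> nonpole (z + INR k).
Proof.
  intros H j E. apply (H (k + j)%nat). rewrite plus_INR, RtoC_plus, <- E. ring.
Qed.

(** Iterated recursion, with the reciprocals listed from the largest shift down to match the factors
    of a falling product. *)
Lemma digamma_shift z k : nonpole z ->
  digamma (z + INR k) - digamma z = Csum (fun i => / (z + INR k - 1 - INR i)) k.
Proof.
  intros Hz. induction k as [|k IH].
  - simpl. rewrite Cplus_0_r. ring.
  - rewrite Csum_shift, RtoC_S, Cplus_assoc, digamma_succ by now apply nonpole_shift.
    rewrite (Csum_ext _ (fun i => / (z + INR k - 1 - INR i)))
      by (intros; rewrite RtoC_S; f_equal; ring).
    rewrite <- IH. change (INR 0) with 0%R.
    replace (z + INR k + 1 - 1 - 0) with (z + INR k) by ring. ring.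
Qed.

Lemma nonpole_not_neg_int x : ~ is_neg_int x -> nonpole (x + 1).
Proof.
  intros H j E. apply H. exists j. rewrite Nat.add_1_r, RtoC_S.
  replace x with (x + 1 + INR j - (INR j + 1)) by ring. rewrite E. ring.
Qed.

Lemma falling_factors_neq_0 x k : ~ is_neg_int x ->
  forall i, (i < k)%nat -> INR (2 * k) + x - INR i <> 0.
Proof.
  intros H i Hi E. apply (nonpole_not_neg_int x H (2 * k - i - 1)%nat). rewrite <- E.
  replace (RtoC (INR (2 * k))) with (INR (2 * k - i - 1) + INR (S i))
    by (rewrite <- RtoC_plus, <- plus_INR; do 2 f_equal; lia).
  rewrite RtoC_S. ring.
Qed.

(** Euler's constant cancels, leaving a digamma difference over k unit steps from k + x + 1. *)
Lemma Harm_diff x k : ~ is_neg_int x ->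
  Harm (INR (2 * k) + x) - Harm (INR k + x) = Csum (fun i => / (INR (2 * k) + x - INR i)) k.
Proof.
  intros H. unfold Harm.
  assert (Hk := nonpole_shift _ k (nonpole_not_neg_int x H)).
  pose proof (digamma_shift _ k Hk) as E. rewrite INR_double.
  replace (2 * INR k + x + 1) with (x + 1 + INR k + INR k) by ring.
  replace (INR k + x + 1) with (x + 1 + INR k) by ring.
  replace (_ - _) with (digamma (x + 1 + INR k + INR k) - digamma (x + 1 + INR k)) by ring.
  rewrite E. apply Csum_ext. intros; f_equal; ring.
Qed.

Lemma dcbin_Harm x k : ~ is_neg_int x ->
  Cbinom (INR (2 * k) + x) k * (Harm (INR (2 * k) + x) - Harm (INR k + x)) = dcbin k x.
Proof.
  intros H. rewrite Harm_diff by auto. unfold dcbin, dCbinom, Cbinom.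
  rewrite dCprod_log by now apply falling_factors_neq_0. field. apply fact_C_neq_0.
Qed.

Lemma not_neg_int_locally' a : locally' a (fun z : C => ~ is_neg_int z).
Proof.
  destruct (poles_isolated (a + 1)) as [eps H].
  assert (P : forall z : C, (Cmod (z - a) < eps)%R -> z <> a -> ~ is_neg_int z).
  { intros z Hz Hne [m Hm].
    refine (H (z + 1) _ _ m _).
    - now replace (z + 1 - (a + 1)) with (z - a) by ring.
    - intros E. apply Hne. replace z with (z + 1 - 1) by ring. rewrite E. ring.
    - rewrite Hm, Nat.add_1_r, RtoC_S. ring. }
  apply locally_C. exists eps. exact P.
Qed.

(** * Entire functions and meromorphy of both sides *)

Definition C_entire (f : C -> C) : Prop :=
  forall z, @ex_derive C_AbsRing C_NormedModule f z.

(* The two normed-module structures on C carry the same norm but different uniform structures. *)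
Lemma is_derive_C_NormedModule (f : C -> C) (z l : C) :
  @is_derive C_AbsRing (AbsRing_NormedModule C_AbsRing) f z l ->
  @is_derive C_AbsRing C_NormedModule f z l.
Proof.
  intros [[L1 L2 L3] D]. split; [constructor; [exact L1 | exact L2 | exact L3] | exact D].
Qed.

Lemma is_derive_C_AbsRing (f : C -> C) (z l : C) :
  @is_derive C_AbsRing C_NormedModule f z l ->
  @is_derive C_AbsRing (AbsRing_NormedModule C_AbsRing) f z l.
Proof.
  intros [[L1 L2 L3] D]. split; [constructor; [exact L1 | exact L2 | exact L3] | exact D].
Qed.

Lemma C_entire_const c : C_entire (fun _ => c).
Proof. intros z. apply @ex_derive_const. Qed.

Lemma C_entire_id : C_entire (fun z => z).
Proof. intros z. exists one. apply is_derive_C_NormedModule, (@is_derive_id C_AbsRing). Qed.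

Lemma C_entire_plus f g : C_entire f -> C_entire g -> C_entire (fun z => f z + g z).
Proof. intros F G z. apply (ex_derive_plus (K := C_AbsRing) (V := C_NormedModule) f g z (F z) (G z)). Qed.

Lemma C_entire_mult f g : C_entire f -> C_entire g -> C_entire (fun z => f z * g z).
Proof.
  intros F G z. destruct (F z) as [df Df], (G z) as [dg Dg]. eexists.
  apply is_derive_C_NormedModule, (is_derive_mult (K := C_AbsRing) f g z df dg);
    auto using is_derive_C_AbsRing, Cmult_comm.
Qed.

(** The exponent 0 works at every point: all singularities of f are removable, with g as the
    extension. *)
Lemma meromorphic_entire (f g : C -> C) : C_entire g -> (forall a : C, locally' a (fun z => f z = g z)) ->
  meromorphic f.
Proof.
  intros G H a. exists 0%nat, g. split.
  - unfold holomorphic_at. apply filter_forall. exact G.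
  - generalize (H a). apply filter_imp. intros z ->. simpl. ring.
Qed.

Lemma C_entire_dcbin k : C_entire (dcbin k).
Proof.
  unfold dcbin, dCbinom.
  assert (L : forall i, C_entire (fun z => INR (2 * k) + z - INR i)).
  { intros i. exact (C_entire_plus _ _
      (C_entire_plus _ _ (C_entire_const _) C_entire_id) (C_entire_const (- INR i))). }
  assert (P : forall m, C_entire (fun z => Cprod (fun i => INR (2 * k) + z - INR i) m)).
  { induction m as [|m IH]; cbn [Cprod]; [apply C_entire_const|].
    apply C_entire_mult; [exact IH | apply L]. }
  apply C_entire_mult; [|apply C_entire_const].
  (* The number of factors is separated from the k in the upper index, which stays fixed in the
     induction. *)
  generalize k at 2. intros m. induction m as [|m IH]; cbn [dCprod]; [apply C_entire_const|].
  apply C_entire_plus; [apply C_entire_mult; auto | apply P].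
Qed.

Lemma C_entire_Csum (F : nat -> C -> C) n :
  (forall k, C_entire (F k)) -> C_entire (fun z => Csum (fun k => F k z) n).
Proof.
  intros H. induction n as [|n IH]; cbn [Csum]; [apply C_entire_const|].
  apply C_entire_plus; auto.
Qed.

Theorem theorem12 (n : nat) :
  let lhs := fun x : C =>
    sum_n (fun k : nat =>
      Cbinom (INR (2 * k) + x) k
      * (Harm (INR (2 * k) + x) - Harm (INR k + x))
      * catalan (n - k)) n in
  let rhs := fun x : C =>
    Cbinom (INR (2 * n) + x + 1) n * (Harm (INR (2 * n) + x) - Harm (INR n + x))
    - INR n / (INR n + x + 1) ^ 2 * Cbinom (INR (2 * n) + x) n in
  mero_eq lhs rhs /\
  forall x : C, ~ is_neg_int x -> lhs x = rhs x.
Proof.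
  intros lhs rhs.
  (* The polynomial with which both sides agree off the negative integers: the left side termwise,
     the right side through [conv_catalan] and [dcbin_succ]. *)
  set (g := fun x => Csum (fun k => dcbin k x * catalan (n - k)) (S n)).
  assert (Hl : forall x, ~ is_neg_int x -> lhs x = g x).
  { intros x Hx. unfold lhs, g. rewrite sum_n_Csum. apply Csum_ext. intros k _.
    now rewrite dcbin_Harm. }
  assert (Hr : forall x, ~ is_neg_int x -> rhs x = g x).
  { intros x Hx. unfold rhs, g. rewrite (conv_catalan dcbin n x dcbin_pascal).
    rewrite dcbin_succ by now apply falling_factors_neq_0.
    now rewrite Harm_diff. }
  assert (Hg : C_entire g).
  { apply C_entire_Csum. intros k. apply C_entire_mult; [apply C_entire_dcbin | apply C_entire_const]. }
  split; [split; [|split]|].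
  - apply (meromorphic_entire _ g Hg). intros a.
    generalize (not_neg_int_locally' a). apply filter_imp. exact Hl.
  - apply (meromorphic_entire _ g Hg). intros a.
    generalize (not_neg_int_locally' a). apply filter_imp. exact Hr.
  - intros a. generalize (not_neg_int_locally' a). apply filter_imp.
    intros x Hx. now rewrite Hl, Hr.
  - intros x Hx. now rewrite Hl, Hr.
Qed.
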